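(* There exists a compact set $K_0$ of diagonal matrices in $\mathbb{R}^{2 \times 2}$ such that the mapping $K \mapsto \overline{L(K)}$, defined on the compact subsets of $\mathbb{R}^{2\times 2}$, is not upper semicontinuous at $K_0$.
   Context: $\mathbb{R}^{m\times n}$ is the space of real $m \times n$ matrices with the Euclidean distance. Two matrices $X,Y$ are rank-one connected if $\operatorname{rank}(X-Y)=1$. A set $\mathcal{S} \subseteq \mathbb{R}^{m\times n}$ is lamination convex if $\lambda X + (1-\lambda) Y \in \mathcal{S}$ for all $\lambda \in [0,1]$ whenever $X,Y \in \mathcal{S}$ are rank-one connected. For $K \subseteq \mathbb{R}^{m \times n}$, $L(K)$ is the smallest lamination convex set containing $K$, and $\overline{L(K)}$ is its closure. For compact $K_1,K_2 \subseteq \mathbb{R}^{m\times n}$ the Hausdorff distance is $\rho(K_1,K_2) = \inf\{\epsilon \geq 0 : K_1 \subseteq U_\epsilon(K_2) \text{ and } K_2 \subseteq U_\epsilon(K_1)\}$, where $U_\epsilon(K)$ is the open $\epsilon$-neighbourhood of $K$ with respect to the Euclidean distance. Let $\mathcal{K}$ be the set of compact subsets of $\mathbb{R}^{m\times n}$. A function $f : \mathcal{K} \to \mathcal{K}$ is upper semicontinuous at $K_0 \in \mathcal{K}$ if for every $\epsilon > 0$ there exists $\delta > 0$ such that $f(K) \subseteq U_\epsilon(f(K_0))$ for all $K \in \mathcal{K}$ with $\rho(K,K_0) < \delta$. *)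

(* Defs.v *)
From HB Require Import structures.
From mathcomp Require Import all_boot all_order all_algebra.
From mathcomp Require Import all_classical all_reals all_analysis.

Set Implicit Arguments.
Unset Strict Implicit.
Unset Printing Implicit Defensive.

Import Order.TTheory GRing.Theory Num.Theory.
Import numFieldNormedType.Exports.

Local Open Scope classical_set_scope.
Local Open Scope ring_scope.

Section Euclidean.
Context {R : realType} {m n : nat}.
Implicit Types (X Y : 'M[R]_(m, n)) (K : set 'M[R]_(m, n)).

Definition edist X Y : R :=
  Num.sqrt (\sum_(i < m) \sum_(j < n) (X i j - Y i j) ^+ 2).

Definition eneighborhood (e : R) K : set 'M[R]_(m, n) :=
  [set X | exists2 Y, K Y & edist X Y < e].

(* The infimum is taken in the extended reals: the distance between the empty
   set and a nonempty set is +oo, whereas the real-valued infimum of the empty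
   set is 0 by convention in the library. *)
Definition hausdorff_dist K1 K2 : \bar R :=
  ereal_inf [set e%:E | e in [set e : R | 0 <= e /\
    (K1 `<=` eneighborhood e K2 /\ K2 `<=` eneighborhood e K1)]].

(* The library topology on matrices comes from the entrywise maximum norm; it
   is the topology of [edist], so that [compact] and [closure] have their
   Euclidean meaning. *)
Lemma nbhs_edistP X (A : set 'M[R]_(m, n)) :
  nbhs X A <-> exists2 e : R, 0 < e & [set Y | edist X Y < e] `<=` A.
Proof.
have sum_ge0 Y : 0 <= \sum_(i < m) \sum_(j < n) (X i j - Y i j) ^+ 2.
  by apply: sumr_ge0 => i _; apply: sumr_ge0 => j _; apply: sqr_ge0.
split.
- move=> /nbhs_ballP[e /= e0 eA]; exists e => // Y /= XY; apply: eA.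
  split=> // i j; rewrite /ball /= -sqrtr_sqr; apply: le_lt_trans XY.
  rewrite ler_wsqrtr// (bigD1 i)//= (bigD1 j)//= -addrA lerDl addr_ge0//.
    by apply: sumr_ge0 => k _; apply: sqr_ge0.
  by apply: sumr_ge0 => k _; apply: sumr_ge0 => l _; apply: sqr_ge0.
- move=> [e e0 eA]; apply/nbhs_ballP.
  pose d := e / (m * n).+1%:R.
  have d0 : 0 < d by rewrite divr_gt0.
  exists d => //= Y [_ XY]; apply: eA => /=.
  rewrite -(ger0_norm (ltW e0)) -sqrtr_sqr ltr_sqrt ?exprn_gt0//.
  apply: (@le_lt_trans _ _ (\sum_(i < m) \sum_(j < n) d ^+ 2)).
    apply: ler_sum => i _; apply: ler_sum => j _.
    rewrite -real_normK ?num_real// lerXn2r ?nnegrE// ?(ltW d0)//.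
    exact/ltW/XY.
  rewrite !sumr_const !card_ord -mulrnA mulnC -mulr_natr.
  rewrite /d expr_div_n -mulrA gtr_pMr ?exprn_gt0// mulrC.
  rewrite ltr_pdivrMr ?exprn_gt0// mul1r -natrX ltr_nat.
  by rewrite -mulnn mulSn -[X in (X < _)%N]addn0 -addSn leq_add.
Qed.

End Euclidean.

Section Lamination.
Context {R : realType} {m n : nat}.
Implicit Types (X Y : 'M[R]_(m, n)) (K S : set 'M[R]_(m, n)).

Definition rank_one_connected X Y := \rank (X - Y)%R = 1%N.

Definition lamination_convex S :=
  forall X Y, S X -> S Y -> rank_one_connected X Y ->
  forall t : R, 0 <= t <= 1 -> S (t *: X + (1 - t) *: Y).

Definition lamination_hull K := smallest lamination_convex K.

Lemma lamination_hull_convex K : lamination_convex (lamination_hull K).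
Proof.
move=> X Y KX KY XY t t01 S [SL KS].
by apply: (SL X Y (KX S _) (KY S _) XY).
Qed.

End Lamination.

Record compact_set (T : topologicalType) := CompactSet {
  compact_set_val :> set T;
  compact_setP : compact compact_set_val }.

Lemma vec_mx_continuous {R : realType} m n :
  continuous (@vec_mx R m n).
Proof.
move=> u; apply/(@cvg_ballP _ _ _ _ (nbhs_filter u)) => e e0.
apply: (@filterS _ _ (nbhs_filter u) _ _ _ (nbhsx_ballx u e e0)) => v [_ uv].
by split=> // i j; rewrite !mxE; apply: uv.
Qed.

Lemma closed_norm_le {R : realType} m n (M : R) :
  closed [set X : 'M[R]_(m, n) | `|X| <= M].
Proof.
have -> : [set X : 'M[R]_(m, n) | `|X| <= M] = Num.norm @^-1` [set r | r <= M].
  by [].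
apply: preimage_closed => [X _|]; last exact: closed_le.
exact: norm_continuous.
Qed.

Lemma compact_norm_le {R : realType} m n (M : R) :
  compact [set X : 'M[R]_(m, n) | `|X| <= M].
Proof.
have := @rV_compact R _ (fun _ : 'I_(m * n) => `[- M, M]%classic)
  (fun _ => @segment_compact _ _ _).
move=> cB.
apply: (@subclosed_compact _ _ (@vec_mx R m n @` _)); first exact: closed_norm_le.
  apply: continuous_compact; last exact: cB.
  by apply: continuous_subspaceT => u; exact: vec_mx_continuous.
move=> X /= XM; exists (mxvec X); last by rewrite mxvecK.
move=> k /=; case/mxvec_indexP: k => i j; rewrite mxvecE in_itv /= -ler_norml.
by apply: le_trans XM; rewrite [leRHS]/Num.norm/= mx_normrE;
   exact: (le_bigmax _ (fun ij => `|X ij.1 ij.2|) (i, j)).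
Qed.

Lemma compact_closure_lamination_hull {R : realType} {m n}
    (K : compact_set 'M[R]_(m, n)) : compact (closure (lamination_hull K)).
Proof.
have [M [_ KM]] := compact_bounded (@compact_setP _ K).
have {}KM : K `<=` [set X | `|X| <= M + 1].
  by move=> X KX; apply: KM => //; rewrite ltrDl.
apply: (subclosed_compact _ (@compact_norm_le R m n (M + 1))).
  exact: closed_closure.
have cM := @closed_norm_le R m n (M + 1).
rewrite [X in _ `<=` X](closure_id _).1//.
apply: closureS; apply: smallest_sub => // X Y /= XM YM _ t /andP[t0 t1].
rewrite (le_trans (ler_normD _ _))// !normrZ ger0_norm// ger0_norm ?subr_ge0//.
have s0 : 0 <= 1 - t by rewrite subr_ge0.
apply: le_trans (lerD (ler_wpM2l t0 XM) (ler_wpM2l s0 YM)) _.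
by rewrite -mulrDl addrC subrK mul1r.
Qed.

Definition closed_lamination_hull {R : realType} {m n}
    (K : compact_set 'M[R]_(m, n)) : compact_set 'M[R]_(m, n) :=
  CompactSet (@compact_closure_lamination_hull R m n K).

Definition upper_semicontinuous_at {R : realType} {m n}
    (f : compact_set 'M[R]_(m, n) -> compact_set 'M[R]_(m, n))
    (K0 : compact_set 'M[R]_(m, n)) :=
  forall eps : R, 0 < eps -> exists2 delta : R, 0 < delta &
    forall K : compact_set 'M[R]_(m, n),
      (hausdorff_dist K K0 < delta%:E)%E ->
      f K `<=` eneighborhood eps (f K0).

(* Main.v *)
Require Import Defs.
From HB Require Import structures.
From mathcomp Require Import all_boot all_order all_algebra.
From mathcomp Require Import all_classical all_reals all_analysis.
From mathcomp Require Import ring lra.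

Import Order.TTheory GRing.Theory Num.Theory.
Import numFieldNormedType.Exports.

Local Open Scope classical_set_scope.
Local Open Scope ring_scope.

(** Diagonal 2x2 matrices form a plane in which the rank-one lines are the
    horizontal and the vertical ones.  The four points (-1,-3), (-3,1), (1,3),
    (3,-1) are a Tartar square: no two of them share a coordinate, but as soon
    as a set contains them and the corner (-1,-1) of the inner square, its
    lamination hull contains the whole inner square.  Let K0 consist of the
    copies of these points scaled by 2^-k, for all k, together with 0.  No two
    points of K0 share a coordinate, so K0 is its own lamination hull.  Adding
    the corner (-2^-n,-2^-n), which is close to 0, fills the inner square of
    scale 2^-n, whose arm reaches the line through the next larger Tartar
    square and produces the corner of scale 2^-(n-1).  Iterating, the
    lamination hull reaches (-1,-1), which is far from K0. *)

(** If [l] is not a cluster point of [F], some member of [F] misses a neighbourhood of [l]. That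
    neighbourhood contains a tail of [u], so [F] lives on finitely many terms, which form a compact
    set. *)
Lemma compact_cvg_range {T : topologicalType} (u : nat -> T) (l : T) :
  u @ \oo --> l -> compact (l |` range u).
Proof.
move=> ul F PF FA.
have [Fl|] := pselect (cluster F l); first by (exists l; split=> //; left).
move=> /existsNP[B /existsNP[N /not_implyP[FB /not_implyP[lN BN0]]]].
have [k _ kN] := ul N lN.
have FC : F (u @` `I_k).
  apply: filterS (filterI FA FB) => x [[->|[n _ <-]] Bx].
    by case: BN0; exists l; split=> //; exact: nbhs_singleton.
  exists n => //=; rewrite ltnNge; apply/negP => kn.
  by apply: BN0; exists (u n); split=> //; exact: kN.
have cC : compact (u @` `I_k).
  by apply: finite_compact; exact/finite_image/finite_II.
have [x [[n _ <-] Fx]] := cC F PF FC.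
by exists (u n); split=> //; right; exists n.
Qed.

Section TartarSquares.
Context {R : realType}.
Implicit Types (a b x y : R) (k n : nat).

(** * Diagonal matrices as points of the plane *)

Definition diag2 x y : 'M[R]_2 := diag_mx (\row_j (if j == 0 then x else y)).

Lemma diag2B x y x' y' : diag2 x y - diag2 x' y' = diag2 (x - x') (y - y').
Proof.
by apply/matrixP => i j; rewrite !mxE; case: ifP => _; rewrite mulrnBl.
Qed.

Lemma diag2_conv t x y x' y' :
  t *: diag2 x y + (1 - t) *: diag2 x' y' =
  diag2 (t * x + (1 - t) * x') (t * y + (1 - t) * y').
Proof.
by apply/matrixP => i j; rewrite !mxE; case: ifP => _; rewrite mulrnDl !mulrnAr.
Qed.

Lemma diag2Z a x y : diag2 (a * x) (a * y) = a *: diag2 x y.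
Proof.
by apply/matrixP => i j; rewrite !mxE; case: ifP => _; rewrite mulrnAr.
Qed.

Lemma rank_diag2 x y : \rank (diag2 x y) = ((x != 0%R) + (y != 0%R))%N.
Proof.
have [->|x0] := eqVneq x 0; have [->|y0] := eqVneq y 0.
- rewrite (_ : diag2 0 0 = 0) ?mxrank0//.
  by apply/matrixP => i j; rewrite !mxE; case: ifP => _; rewrite mul0rn.
- rewrite (_ : diag2 0 y = y *: delta_mx 1 1) ?mxrank_scale_nz ?mxrank_delta//.
  apply/matrixP => i j; rewrite !mxE.
  by case: i j => -[|[|//]] ? [[|[|//]] ?] /=;
    rewrite ?mulr1n ?mulr0n ?mulr0 ?mulr1.
- rewrite (_ : diag2 x 0 = x *: delta_mx 0 0) ?mxrank_scale_nz ?mxrank_delta//.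
  apply/matrixP => i j; rewrite !mxE.
  by case: i j => -[|[|//]] ? [[|[|//]] ?] /=;
    rewrite ?mulr1n ?mulr0n ?mulr0 ?mulr1.
- rewrite mxrank_unit// unitmxE det_diag !big_ord_recl big_ord0 !mxE/=.
  by rewrite mulr1 unitfE mulf_neq0.
Qed.

Lemma rank_one_connected_diag2 x y x' y' :
  rank_one_connected (diag2 x y) (diag2 x' y') <-> (x == x') != (y == y').
Proof.
rewrite /rank_one_connected diag2B rank_diag2 !subr_eq0.
by case: (x == x'); case: (y == y').
Qed.

Lemma edist_diag2 x y x' y' :
  Defs.edist (diag2 x y) (diag2 x' y') =
  Num.sqrt ((x - x') ^+ 2 + (y - y') ^+ 2).
Proof.
rewrite /Defs.edist !big_ord_recl !big_ord0 !mxE /= !mulr1n !mulr0n.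
by congr Num.sqrt; ring.
Qed.

(** * The scaled Tartar squares and their limit *)

Definition scales : set R := 0 |` range (fun k => 2^-1 ^+ k).

Lemma compact_scales : compact scales.
Proof.
by apply: compact_cvg_range; apply: cvg_expr; rewrite ger0_norm; lra.
Qed.

Lemma scales_ge0 a : scales a -> 0 <= a.
Proof. by move=> [->//|[k _ <-]]; rewrite exprn_ge0// invr_ge0. Qed.

(** Clearing denominators turns 2^-k = 3 * 2^-l into 2^l = 3 * 2^k, but 3 divides no power of 2.
    This keeps squares of different scales from sharing a coordinate. *)
Lemma scales_neq3 a b : scales a -> scales b -> a = 3 * b -> b = 0.
Proof.
move=> + [->//|[l _ <-]] => -[->|[k _ <-]].
  by move=> /esym/eqP; rewrite mulf_eq0 pnatr_eq0 /= => /eqP.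
rewrite !exprVn => /(congr1 (fun z => z * (2 ^+ k * 2 ^+ l))).
have u2 n : (2 : R) ^+ n != 0 by rewrite expf_neq0// pnatr_eq0.
rewrite mulrA mulVf// mul1r (mulrC (2 ^+ k)) mulrA mulfVK// -!natrX -natrM.
move=> /eqP; rewrite eqr_nat => /eqP e.
have : (3 %| 2 ^ l)%N by rewrite e dvdn_mulr.
by rewrite Euclid_dvdX.
Qed.

Definition tartar_ray x y : set 'M[R]_2 :=
  (fun a => diag2 (a * x) (a * y)) @` scales.

Definition tartar : set 'M[R]_2 :=
  tartar_ray (-1) (-3) `|` tartar_ray (-3) 1 `|`
  (tartar_ray 1 3 `|` tartar_ray 3 (-1)).

Lemma compact_tartar : compact tartar.
Proof.
have cr x y : compact (tartar_ray x y).
  apply: continuous_compact; last exact: compact_scales.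
  apply: continuous_subspaceT.
  under [X in continuous X]eq_fun do rewrite diag2Z.
  exact: scalel_continuous.
by do 2![apply: compactU]; apply: cr.
Qed.

Lemma tartarP X : tartar X -> exists x y a, [/\ X = diag2 x y, scales a &
  [\/ x = - a /\ y = - (3 * a), x = - (3 * a) /\ y = a,
      x = a /\ y = 3 * a | x = 3 * a /\ y = - a]].
Proof.
move=> [[]|[]] [a aS <-]; do 3 eexists; (split; [reflexivity|exact: aS|]).
- by apply: Or41; split; ring.
- by apply: Or42; split; ring.
- by apply: Or43; split; ring.
- by apply: Or44; split; ring.
Qed.

(** Holds vacuously: coordinates have absolute value [a] or [3 * a], so a shared one forces equal
    scales on the same ray, or both scales to be 0. Either way the two points coincide. *)
Lemma lamination_convex_tartar : lamination_convex tartar.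
Proof.
move=> _ _ /tartarP[x [y [a [-> Sa xy]]]] /tartarP[x' [y' [b [-> Sb xy']]]].
move=> /rank_one_connected_diag2 r1 t _; exfalso.
have a0 := scales_ge0 _ Sa; have b0 := scales_ge0 _ Sb.
have ab := scales_neq3 _ _ Sa Sb; have ba := scales_neq3 _ _ Sb Sa.
have [xE yE] : (x = x' -> y = y') /\ (y = y' -> x = x').
  have [/ab b00|/eqP aN] := eqVneq a (3 * b).
    by split=> ?; case: xy => -[? ?]; case: xy' => -[? ?]; lra.
  have [/ba a00|/eqP bN] := eqVneq b (3 * a).
    by split=> ?; case: xy => -[? ?]; case: xy' => -[? ?]; lra.
  split=> ?; case: xy => -[? ?]; case: xy' => -[? ?]; try lra; exfalso;
    by [apply: aN; lra|apply: bN; lra].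
move: r1; have [/xE ->|nx] := eqVneq x x'; first by rewrite eqxx.
by have [/yE e|] := eqVneq y y'; first by rewrite e eqxx in nx.
Qed.

Lemma lamination_hull_tartar : lamination_hull tartar = tartar.
Proof.
apply/seteqP; split; last exact: sub_gen_smallest.
exact: smallest_sub lamination_convex_tartar _.
Qed.

(** * Growth of the hull from a small corner to a large one *)

Lemma lamination_convex_tartar_step (S : set 'M[R]_2) a :
  lamination_convex S ->
  S (diag2 (3 * a) (- a)) -> S (diag2 a (3 * a)) -> S (diag2 (- (3 * a)) a) ->
  S (diag2 (- (2 * a)) (- (6 * a))) ->
  S (diag2 (- a) (- a)) -> S (diag2 (- (2 * a)) (- (2 * a))).
Proof.
move=> SL S4 S3 S2 S1 c.
(* For [a = 0] the segments used below degenerate, but start and target are both the origin. *)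
have [a0|a0] := eqVneq a 0.
  by move: c; rewrite a0 !(mulr0, oppr0).
have seg t x y x' y' : 0 <= t <= 1 -> S (diag2 x y) -> S (diag2 x' y') ->
    (x == x') != (y == y') ->
    S (diag2 (t * x + (1 - t) * x') (t * y + (1 - t) * y')).
  move=> t01 SX SY /rank_one_connected_diag2 XY.
  by rewrite -diag2_conv; exact: SL.
have ne x y : (exists2 c, c != 0 & x - y = c * a) -> (x == y) = false.
  by move=> [d d0 e]; apply/negbTE; rewrite -subr_eq0 e mulf_neq0.
have c' : S (diag2 a (- a)).
  have := seg (1/2) _ _ _ _ _ c S4;
    rewrite eqxx ne; last by exists (-4); [rewrite ?oppr_eq0 pnatr_eq0|ring].
  by move=> /(_ ltac:(lra) isT); congr (S (diag2 _ _)); field.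
have c'' : S (diag2 a a).
  have := seg (1/2) _ _ _ _ _ c' S3;
    rewrite eqxx ne; last by exists (-4); [rewrite ?oppr_eq0 pnatr_eq0|ring].
  by move=> /(_ ltac:(lra) isT); congr (S (diag2 _ _)); field.
(* From (a, a) towards (-3a, a): weight 1/4 stops at the abscissa -2a of the vertex (-2a, -6a) of
   the next larger square. *)
have d : S (diag2 (- (2 * a)) a).
  have := seg (1/4) _ _ _ _ _ c'' S2;
    rewrite eqxx ne; last by exists 4; [rewrite ?oppr_eq0 pnatr_eq0|ring].
  by move=> /(_ ltac:(lra) isT); congr (S (diag2 _ _)); field.
(* The ordinate runs from a to -6a, and -2a lies 3/7 of the way. *)
have := seg (4/7) _ _ _ _ _ d S1;
    rewrite eqxx ne; last by exists 7; [rewrite ?oppr_eq0 pnatr_eq0|ring].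
by move=> /(_ ltac:(lra) isT); congr (S (diag2 _ _)); field.
Qed.

Lemma lamination_convex_tartar_corner (S : set 'M[R]_2) n :
  lamination_convex S -> tartar `<=` S ->
  S (diag2 (- 2^-1 ^+ n) (- 2^-1 ^+ n)) -> S (diag2 (-1) (-1)).
Proof.
move=> SL KS; elim: n => [|n IH] //.
have St k : scales (2^-1 ^+ k) by right; exists k.
have e : 2^-1 ^+ n = 2 * 2^-1 ^+ n.+1 :> R.
  by rewrite exprS mulrA mulfV ?mul1r// pnatr_eq0.
move=> Sn; apply: IH; rewrite e.
apply: lamination_convex_tartar_step => //; apply: KS.
- by right; right; exists (2^-1 ^+ n.+1) => //; congr diag2; ring.
- by right; left; exists (2^-1 ^+ n.+1) => //; congr diag2; ring.
- by left; right; exists (2^-1 ^+ n.+1) => //; congr diag2; ring.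
(* Only this vertex belongs to the square of twice the scale. *)
- by left; left; exists (2^-1 ^+ n) => //; rewrite e; congr diag2; ring.
Qed.

(** Within 1/2 of the corner both coordinates lie in (-3/2, -1/2). Both being negative leaves only
    the ray of (-1, -3), where a > 1/2 pushes the second coordinate below -3/2. *)
Lemma corner_far_tartar : ~ eneighborhood 2^-1 tartar (diag2 (-1) (-1)).
Proof.
move=> [_ /tartarP[x [y [a [-> /scales_ge0 a0 xy]]]]].
have h0 : 0 <= 2^-1 :> R by rewrite invr_ge0.
rewrite edist_diag2 -[X in _ < X]ger0_norm// -sqrtr_sqr.
rewrite ltr_sqrt ?exprn_gt0 ?invr_gt0// => lt.
have lx : (-1 - x) ^+ 2 < 2^-1 ^+ 2.
  by apply: le_lt_trans lt; rewrite lerDl sqr_ge0.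
have ly : (-1 - y) ^+ 2 < 2^-1 ^+ 2.
  by apply: le_lt_trans lt; rewrite lerDr sqr_ge0.
have sqr_lt (z : R) : z ^+ 2 < 2^-1 ^+ 2 -> `|z| < 2^-1.
  by rewrite -(real_normK (num_real z)) ltr_pXn2r// nnegrE.
move: (sqr_lt _ lx) (sqr_lt _ ly).
rewrite !ltr_norml => /andP[? ?] /andP[? ?].
by case: xy => -[? ?]; lra.
Qed.

Lemma hausdorff_dist_tartar_corner a : 0 < a ->
  (hausdorff_dist (tartar `|` [set diag2 (- a) (- a)]) tartar <= (2 * a)%:E)%E.
Proof.
move=> a0; apply: ereal_inf_lbound; exists (2 * a) => //.
have edist_refl (X : 'M[R]_2) : Defs.edist X X = 0.
  by rewrite /Defs.edist big1 ?sqrtr0// => i _;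
    rewrite big1// => j _; rewrite subrr expr0n.
have a2 : 0 < 2 * a by lra.
split; [exact: ltW|split].
- move=> X [KX|->]; first by exists X => //; rewrite edist_refl.
  (* The added corner is at distance sqrt 2 * a < 2 * a from the origin, the point of [tartar] of
     scale 0. *)
  exists (diag2 0 0).
    by left; left; exists 0; [left|rewrite !mul0r].
  rewrite edist_diag2 -[X in _ < X]ger0_norm ?ltW// -sqrtr_sqr.
  rewrite ltr_sqrt ?exprn_gt0//.
  by rewrite !subr0; nra.
- by move=> X KX; exists X; [left|rewrite edist_refl].
Qed.

End TartarSquares.

Theorem theorem2p1 (R : realType) :
  exists K0 : compact_set 'M[R]_(2, 2),
    K0 `<=` [set X : 'M[R]_(2, 2) | is_diag_mx X] /\
    ~ upper_semicontinuous_at closed_lamination_hull K0.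
Proof.
exists (CompactSet compact_tartar); split.
  by move=> _ /tartarP[x [y [a [-> _ _]]]]; exact: diag_mx_is_diag.
move=> /(_ 2^-1 ltac:(by rewrite invr_gt0))[d d0 usc].
have : (fun n => 2 * 2^-1 ^+ n) @ \oo --> (2 * 0 : R).
  apply: cvgM; first exact: cvg_cst.
  by apply: cvg_expr; rewrite ger0_norm; lra.
rewrite mulr0 => /cvgr_lt /(_ d d0)[n _ /(_ n (leqnn n))].
rewrite -lte_fin => nd.
have cK : compact (@tartar R `|` [set diag2 (- 2^-1 ^+ n) (- 2^-1 ^+ n)]).
  by apply: compactU; [exact: compact_tartar|exact: compact_set1].
have := usc (CompactSet cK).
(* Being closed and its own lamination hull, [tartar] is its own closed hull, so [usc] bounds the
   hull of the enlarged set by the 1/2-neighbourhood of [tartar]. *)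
have cl : closed (@tartar R).
  by apply: compact_closed compact_tartar; exact: norm_hausdorff.
rewrite /= lamination_hull_tartar -((closure_id _).1 cl).
have h0 : 0 < 2^-1 ^+ n :> R by rewrite exprn_gt0// invr_gt0.
have hd := hausdorff_dist_tartar_corner _ h0.
move=> /(_ (le_lt_trans hd nd)) hullK; apply: corner_far_tartar; apply: hullK.
apply: subset_closure.
apply: (@lamination_convex_tartar_corner _ (lamination_hull _) n).
- exact: lamination_hull_convex.
- by move=> X KX; apply: sub_gen_smallest; left.
- by apply: sub_gen_smallest; right.
Qed.
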